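(* Let $1>\epsilon>0$, let $d$ be constant, and let $G\in\mathcal{G}_{n,d}$ be a random $d$-regular graph on $n$ vertices. Let $H$ be any fixed, connected (finite) graph, and let $f_n:V(G)\to V(H)$ be any sequence of functions. There exists a constant $C$ such that $$\mathbb{P}\left(\gamma(G,d_H,f_n)\le C\right)\to 1\quad\text{as } n\to\infty.$$
   Context: $\mathcal{G}_{n,d}$ denotes the uniform probability space of simple $d$-regular graphs on the vertex set $[n]=\{1,\dots,n\}$ ($nd$ even). The functions $f_n$ are deterministic: for each $n$, $f_n$ is a fixed map from the label set $[n]=V(G)$ to $V(H)$, not depending on the random graph $G$. $d_H$ is the usual graph distance on $V(H)$. For a $d$-regular graph $G$ on $n$ vertices and $f:V(G)\to V(H)$, $\gamma(G,d_H,f)$ is the number satisfying $$\frac{\gamma(G,d_H,f)}{dn}\sum_{u\sim_G v} d_H^2(f(u),f(v))=\frac{1}{n^2}\sum_{u,v\in V(G)}d_H^2(f(u),f(v)),$$ where the first sum is over adjacent pairs $u,v$ in $G$ and the second over all pairs of vertices of $G$; the statement $\gamma(G,d_H,f)\le C$ means that $\frac{1}{n^2}\sum_{u,v\in V(G)}d_H^2(f(u),f(v))\le\frac{C}{dn}\sum_{u\sim_G v} d_H^2(f(u),f(v))$ (so it holds trivially for constant $f$). The parameter $\epsilon$ appears in the statement but does not occur in the conclusion. *)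

(* Defs.v *)
From HB Require Import structures.
From mathcomp Require Import all_boot all_order all_algebra.
From mathcomp Require Import boolp classical_sets reals topology normedtype.

Set Implicit Arguments.
Unset Strict Implicit.
Unset Printing Implicit Defensive.

Import Order.TTheory GRing.Theory Num.Theory.
Import numFieldNormedType.Exports.

Local Open Scope ring_scope.

Definition simple_adj (T : finType) (a : {ffun T * T -> bool}) : bool :=
  [forall x, forall y, a (x, y) == a (y, x)] && [forall x, ~~ a (x, x)].

Record sgraph (T : finType) := SGraph {
  sgraph_val :> {ffun T * T -> bool};
  sgraphP : simple_adj sgraph_val
}.

HB.instance Definition _ (T : finType) := [isSub for @sgraph_val T].
HB.instance Definition _ (T : finType) := [Finite of sgraph T by <:].

Definition adj (T : finType) (G : sgraph T) : rel T :=
  fun x y => sgraph_val G (x, y).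

Definition connected_graph (T : finType) (G : sgraph T) : Prop :=
  forall x y : T, connect (adj G) x y.

Definition has_walk (T : finType) (G : sgraph T) (x y : T) (k : nat) : bool :=
  [exists p : k.-tuple T, path (adj G) x p && (last x p == y)].

Lemma connected_has_walk (T : finType) (G : sgraph T) :
  connected_graph G -> forall x y : T, exists k, has_walk G x y k.
Proof.
move=> cG x y; have /connectP[p pP ->] := cG x y.
by exists (size p); apply/existsP; exists (in_tuple p); rewrite pP eqxx.
Qed.

Definition dist (T : finType) (G : sgraph T) (cG : connected_graph G)
  (x y : T) : nat := ex_minn (connected_has_walk cG x y).

Definition regular (T : finType) (d : nat) (G : sgraph T) : bool :=
  [forall x, #|[set y | adj G x y]| == d].

(* Nonlinear Poincare constant of f : T -> W into a space with distance rho.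
   Both sums range over ordered pairs, so for d-regular G the edge sum has
   d * #|T| terms.  The constant is the ratio of two averages that may both
   vanish (e.g. for constant f), hence the division-free form of "<= C". *)
Definition gamma_le (R : realType) (T : finType) (W : Type) (d : nat)
    (G : sgraph T) (rho : W -> W -> nat) (f : T -> W) (C : R) : bool :=
  1 / #|T|%:R ^+ 2 * (\sum_(u : T) \sum_(v : T) (rho (f u) (f v))%:R ^+ 2)
  <= C / (d%:R * #|T|%:R) *
     (\sum_(u : T) \sum_(v : T | adj G u v) (rho (f u) (f v))%:R ^+ 2).

(* Uniform probability on the d-regular simple graphs with vertex set 'I_n;
   by the convention x / 0 = 0 it is 0 when there is no such graph. *)
Definition prob_regular (R : realType) (n d : nat)
    (E : pred (sgraph 'I_n)) : R :=
  #|[set G : sgraph 'I_n | regular d G && E G]|%:R /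
  #|[set G : sgraph 'I_n | regular d G]|%:R.

(* Main.v *)
Require Import Defs.
From mathcomp Require Import all_boot all_order all_algebra.
From mathcomp Require Import fingroup perm.
From mathcomp Require Import ring lra zify.
From mathcomp Require Import boolp classical_sets reals topology normedtype.

Set Implicit Arguments.
Unset Strict Implicit.
Unset Printing Implicit Defensive.

Import Order.TTheory GRing.Theory Num.Theory.
Import numFieldNormedType.Exports.

Local Open Scope ring_scope.

(** The map [f n] takes at most [#|V|] values and [dist cH] is bounded by the
    diameter [D] of [H], so the Poincare inequality reduces to a statement about
    the cuts between each fiber [A] of [f n] and its complement.  If the number
    of edges leaving each fiber is at least half its mean over random regular
    graphs, then the proportion of edges joining different fibers is at least
    half the proportion of pairs lying in different fibers, and [C = 2 * D ^+ 2]
    works ([gamma_le_thick]).  The fibers are chosen before the graph is drawn,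
    so all that matters is that each of boundedly many fixed cuts is
    concentrated; this is why the result covers [d <= 2], where random graphs
    are not expanders.

    Concentration is Chebyshev's inequality, and the second moment is computed
    exactly from the symmetry of the uniform measure under relabelling of the
    vertices.  If [w] is a function of the graph which does not distinguish the
    vertices outside a set [S], then, weighted by [w], every vertex outside [S]
    has the same chance to be a neighbour of a given [x] in [S], while the
    number of neighbours of [x] outside [S] is [d] minus those inside
    ([regsum_edge_resample]).  Revealing edges one at a time this way gives the
    probability of one edge, of two edges at a common vertex, and of two disjoint
    edges.  For [a = #|A|], [m = n - a] and mean [mu = a m d / (n - 1)] the
    variance of the cut is
      2 mu (a - 1) (m - 1) (n - 1 - d) / ((n - 1) (n - 2) (n - 3))
    ([cut_variance]), at most [5 mu ^+ 2 / n] whatever the size of [A].  Hence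
    a fiber has a cut below [mu / 2] with probability at most [20 / n]
    ([regsum_thin_cut]), and a union bound over the fibers finishes the proof
    ([regsum_not_gamma_le]).

    The probability is a quotient of cardinals whose denominator must not
    vanish: circulant graphs show that [d]-regular graphs exist as soon as
    [d < n] and [n d] is even ([exists_regular]). *)

(** * Relabelling the vertices of a graph *)

Lemma adj_sym (T : finType) (G : sgraph T) x y : adj G x y = adj G y x.
Proof.
have /andP[/forallP gs _] := sgraphP G.
by rewrite /adj (eqP (forallP (gs x) y)).
Qed.

Lemma adj_irr (T : finType) (G : sgraph T) x : adj G x x = false.
Proof. by have /andP[_ /forallP gi] := sgraphP G; apply/negbTE/gi. Qed.

Lemma relabel_subproof (T : finType) (s : {perm T}) (G : sgraph T) :
  simple_adj [ffun p : T * T => adj G (s p.1) (s p.2)].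
Proof.
apply/andP; split.
  by apply/forallP => x; apply/forallP => y; rewrite !ffunE /= adj_sym.
by apply/forallP => x; rewrite ffunE /= adj_irr.
Qed.

Definition relabel (T : finType) (s : {perm T}) (G : sgraph T) : sgraph T :=
  SGraph (relabel_subproof s G).

Lemma adj_relabel (T : finType) (s : {perm T}) (G : sgraph T) x y :
  adj (relabel s G) x y = adj G (s x) (s y).
Proof. by rewrite /adj /= ffunE. Qed.

Lemma relabel_inj (T : finType) (s : {perm T}) : injective (@relabel T s).
Proof.
move=> G G' eqG; apply: val_inj; apply/ffunP => -[x y].
have := adj_relabel s G (s^-1 x)%g (s^-1 y)%g.
by rewrite eqG adj_relabel !permKV.
Qed.

Lemma regular_relabel (T : finType) d (s : {perm T}) (G : sgraph T) :
  regular d (relabel s G) = regular d G.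
Proof.
have card_nbhs x : #|[set y | adj (relabel s G) x y]| =
    #|[set y | adj G (s x) y]|.
  rewrite -(card_imset _ (@perm_inj _ s)); congr #|pred_of_set _|.
  apply/setP => y; rewrite inE -(permKV s y) mem_imset ?inE ?adj_relabel //.
  exact: perm_inj.
apply/forallP/forallP => rG x; last by rewrite card_nbhs.
by rewrite -(permKV s x) -card_nbhs.
Qed.

(** * Exact moments of edge counts in random regular graphs *)

Section Moments.
Variables (R : realFieldType) (T : finType) (d : nat).
Implicit Types (G : sgraph T) (S A : {set T}) (w : sgraph T -> R).

(** The expectation of [w] over random [d]-regular graphs, times the number of
    such graphs: not dividing keeps the identities valid when there are none. *)
Definition regsum w : R := \sum_(G : sgraph T | regular d G) w G.

Definition edge G x y : R := (adj G x y)%:R.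

Local Notation n := #|T|%:R.
Local Notation N := (regsum (fun=> 1)).

Lemma eq_regsum w1 w2 : (forall G, regular d G -> w1 G = w2 G) ->
  regsum w1 = regsum w2.
Proof. exact: eq_bigr. Qed.

Lemma regsum_relabel s w : regsum (fun G => w (relabel s G)) = regsum w.
Proof.
rewrite /regsum [RHS](reindex_inj (@relabel_inj _ s)) /=.
by apply: eq_bigl => G; rewrite regular_relabel.
Qed.

Lemma sum_edge G x : regular d G -> \sum_y edge G x y = d%:R.
Proof.
move=> /forallP/(_ x)/eqP <-; rewrite -sum1_card natr_sum [RHS]big_mkcond /=.
by apply: eq_bigr => y _; rewrite inE /edge; case: (adj G x y).
Qed.

(** Swapping two vertices outside [S] preserves [w], so [y] may be replaced by any
    vertex outside [S]; summing over all of them counts the neighbours of [x]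
    outside [S], and regularity turns this count into the ones inside [S]. *)
Lemma regsum_edge_resample S x y w :
    x \in S -> y \notin S ->
    (forall G u v, u \notin S -> v \notin S ->
      w (relabel (tperm u v) G) = w G) ->
  (n - #|S|%:R) * regsum (fun G => w G * edge G x y) =
  regsum (fun G => w G * (d%:R - \sum_(z in S) edge G x z)).
Proof.
move=> xS yS w_inv.
have -> : n - #|S|%:R = #|~: S|%:R :> R by rewrite -(cardsC S) natrD addrC addKr.
have swap z : z \in ~: S ->
    regsum (fun G => w G * edge G x y) = regsum (fun G => w G * edge G x z).
  rewrite inE => zS; rewrite -(regsum_relabel (tperm y z)).
  apply: eq_regsum => G _; rewrite w_inv // /edge adj_relabel tpermL tpermD //.
    by apply: contraNneq yS => ->.
  by apply: contraNneq zS => ->.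
rewrite mulr_natl -sumr_const (eq_bigr _ swap) exchange_big /=.
apply: eq_bigr => G regG; rewrite -mulr_sumr; congr (_ * _).
rewrite -(sum_edge x regG) (bigID [in S] predT) /= addrAC subrr add0r.
by apply: eq_bigl => z; rewrite inE.
Qed.

Lemma edgexx G x : edge G x x = 0.
Proof. by rewrite /edge adj_irr. Qed.

Lemma edgeC G x y : edge G x y = edge G y x.
Proof. by rewrite /edge adj_sym. Qed.

Lemma edge_sqr G x y : edge G x y * edge G x y = edge G x y.
Proof. by rewrite /edge; case: adj; rewrite ?mulr1 ?mulr0. Qed.

Lemma regsumD w1 w2 : regsum (fun G => w1 G + w2 G) = regsum w1 + regsum w2.
Proof. by rewrite /regsum big_split. Qed.

Lemma regsumB w1 w2 : regsum (fun G => w1 G - w2 G) = regsum w1 - regsum w2.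
Proof. by rewrite /regsum sumrB. Qed.

Lemma regsumZ c w : regsum (fun G => c * w G) = c * regsum w.
Proof. by rewrite /regsum mulr_sumr. Qed.

Lemma regsum_sum (I : finType) (P : pred I) (F : I -> sgraph T -> R) :
  regsum (fun G => \sum_(i | P i) F i G) = \sum_(i | P i) regsum (F i).
Proof. exact: exchange_big. Qed.

Lemma regsum_edge u v : u != v ->
  (n - 1) * regsum (fun G => edge G u v) = d%:R * N.
Proof.
move=> uv; have := @regsum_edge_resample [set u] u v (fun=> 1).
rewrite cards1 !inE eq_sym => /(_ (eqxx _) uv (fun _ _ _ _ _ => erefl)).
have -> : regsum (fun G => 1 * edge G u v) = regsum (fun G => edge G u v).
  by apply: eq_regsum => G _; rewrite mul1r.
move=> ->; rewrite -regsumZ; apply: eq_regsum => G _.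
by rewrite big_set1 edgexx subr0 mulrC.
Qed.

(** Given the edge [u v], the other [d - 1] neighbours of [u] are exchangeable
    among the [n - 2] remaining vertices. *)
Lemma regsum_edge2_adjacent u v y : u != v -> u != y -> v != y ->
  (n - 2) * regsum (fun G => edge G u v * edge G u y) =
  (d%:R - 1) * regsum (fun G => edge G u v).
Proof.
move=> uv uy vy.
have := @regsum_edge_resample [set u; v] u y (fun G => edge G u v).
rewrite cards2 uv => ->; rewrite ?inE ?eqxx //.
- rewrite -regsumZ; apply: eq_regsum => G _.
  rewrite big_setU1 ?inE //= big_set1 edgexx add0r mulrBr edge_sqr; ring.
- by rewrite negb_or eq_sym uy eq_sym.
move=> G x z; rewrite !inE !negb_or => /andP[xu xv] /andP[zu zv].
by rewrite /edge adj_relabel !tpermD.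
Qed.

(** Given the edge [u v], the neighbours of [x] other than [u] and [v] are
    exchangeable among the [n - 3] remaining vertices; the two subtracted terms
    are the cases where [x] is adjacent to [u] or to [v]. *)
Lemma regsum_edge2_disjoint u v x y : uniq [:: u; v; x; y] ->
  (n - 3) * regsum (fun G => edge G u v * edge G x y) =
  d%:R * regsum (fun G => edge G u v)
  - regsum (fun G => edge G u v * edge G u x)
  - regsum (fun G => edge G v u * edge G v x).
Proof.
rewrite /= !inE !negb_or !andbT => /and3P[/and3P[uv ux uy] /andP[vx vy] xy].
have := @regsum_edge_resample [set u; v; x] x y (fun G => edge G u v).
have -> : #|[set u; v; x]| = 3%N.
  by rewrite finset.setUC cardsU1 !inE cards2 uv negb_or ![x == _]eq_sym ux vx.
move=> ->; rewrite ?inE ?eqxx ?orbT //.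
- rewrite -regsumZ -!regsumB; apply: eq_regsum => G _.
  rewrite finset.setUC big_setU1 ?inE ?negb_or ?[x == _]eq_sym ?ux ?vx //=.
  rewrite big_setU1 ?inE //= big_set1 edgexx add0r.
  rewrite (edgeC G x u) (edgeC G x v) (edgeC G v u); ring.
- by rewrite !negb_or ![y == _]eq_sym uy vy.
move=> G z t; rewrite !inE !negb_or.
move=> /andP[/andP[zu zv] _] /andP[/andP[tu tv] _].
by rewrite /edge adj_relabel !tpermD.
Qed.

Definition cut G A : R := \sum_(u in A) \sum_(v in ~: A) edge G u v.

(** Splits a double sum according to which coordinates it shares with [(u, v)];
    applied to pairs of edges of a cut, whose joint weight depends only on
    whether they are equal, share an end, or are disjoint. *)
Lemma sum_grid A (B : {set T}) u v (F : T -> T -> R) b c :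
    u \in A -> v \in B ->
    (forall y, y \in B -> y != v -> F u y = b) ->
    (forall x, x \in A -> x != u -> F x v = b) ->
    (forall x y, x \in A -> x != u -> y \in B -> y != v -> F x y = c) ->
  \sum_(x in A) \sum_(y in B) F x y =
  F u v + (#|A|%:R + #|B|%:R - 2) * b + (#|A|%:R - 1) * (#|B|%:R - 1) * c.
Proof.
move=> uA vB Fu Fv F'.
have sumC (S : {set T}) (z : T) (g : T -> R) (k : R) : z \in S ->
    (forall x, x \in S -> x != z -> g x = k) ->
    \sum_(x in S) g x = g z + (#|S|%:R - 1) * k.
  move=> zS gk; have -> : #|S|%:R - 1 = #|S :\ z|%:R :> R.
    by rewrite (cardsD1 z S) zS natrD addrC addKr.
  rewrite (big_setD1 z) //= mulr_natl -sumr_const; congr (_ + _); apply: eq_bigr => x.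
  by rewrite !inE => /andP[xz xS]; apply: gk.
rewrite (sumC A u _ (b + (#|B|%:R - 1) * c)) //.
  by rewrite (sumC B v _ b) //; ring.
by move=> x xA xu; rewrite (sumC B v _ c) // ?Fv // => y yB yv; apply: F'.
Qed.

Section LargeOrder.
Hypothesis n_ge4 : (4 <= #|T|)%N.
Variable A : {set T}.
Let a : R := #|A|%:R.
Let m : R := #|~: A|%:R.
Let mu : R := a * m * d%:R / (n - 1).

Let n4 : 4 <= n :> R. Proof. by rewrite (ler_nat R 4). Qed.
Let n1 : n - 1 != 0 :> R. Proof. by apply: lt0r_neq0; move: n4; lra. Qed.
Let n2 : n - 2 != 0 :> R. Proof. by apply: lt0r_neq0; move: n4; lra. Qed.
Let n3 : n - 3 != 0 :> R. Proof. by apply: lt0r_neq0; move: n4; lra. Qed.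
Let am : a + m = n. Proof. by rewrite -natrD cardsC. Qed.

Lemma regsum_edgeE u v : u != v ->
  regsum (fun G => edge G u v) = d%:R / (n - 1) * N.
Proof. by move=> uv; apply: (mulfI n1); rewrite regsum_edge //; field. Qed.

Lemma regsum_cut : regsum (cut^~ A) = mu * N.
Proof.
rewrite regsum_sum (eq_bigr (fun=> m * (d%:R / (n - 1) * N))).
  by rewrite sumr_const -[LHS]mulr_natl -/a /mu; field.
move=> u uA; rewrite regsum_sum (eq_bigr (fun=> d%:R / (n - 1) * N)).
  by rewrite sumr_const -[LHS]mulr_natl.
move=> v; rewrite inE => vA; apply: regsum_edgeE.
by apply: contraNneq vA => <-.
Qed.

(** Given the cut edge [u v], the expected size of the cut is [d], from the edges
    meeting [u v], plus a term from the disjoint edges that vanishes when one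
    side is a single vertex and the cut is deterministic. *)
Lemma regsum_edge_cut u v : u \in A -> v \in ~: A ->
  regsum (fun G => edge G u v * cut G A) =
  d%:R / (n - 1) * N *
  (d%:R + (a - 1) * (m - 1) * ((n - 4) * d%:R + 2) / ((n - 2) * (n - 3))).
Proof.
move=> uA vA; have neq x y : x \in A -> y \in ~: A -> x != y.
  by rewrite inE => xA; apply: contraNneq => <-.
(* b and c are the weights of two edges sharing an end, resp. disjoint. *)
pose b := (d%:R - 1) / (n - 2) * (d%:R / (n - 1) * N).
pose c := (d%:R * (d%:R / (n - 1) * N) - 2 * b) / (n - 3).
have p3 x y z : x != y -> x != z -> y != z ->
    regsum (fun G => edge G x y * edge G x z) = b.
  move=> xy xz yz; apply: (mulfI n2); rewrite regsum_edge2_adjacent //.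
  by rewrite regsum_edgeE // /b; field; rewrite n1 n2.
transitivity (\sum_(x in A) \sum_(y in ~: A)
    regsum (fun G => edge G u v * edge G x y)).
  rewrite -[RHS](eq_bigr _ (fun _ _ => regsum_sum _ _)) -regsum_sum.
  apply: eq_regsum => G _; rewrite mulr_sumr.
  by apply: eq_bigr => x _; rewrite mulr_sumr.
rewrite (@sum_grid _ _ u v _ b c) //=.
- rewrite -/a -/m am.
  have -> : regsum (fun G => edge G u v * edge G u v) = d%:R / (n - 1) * N.
    rewrite -(regsum_edgeE (neq _ _ uA vA)).
    by apply: eq_regsum => G _; rewrite edge_sqr.
  by rewrite /c /b; field; rewrite n1 n2 n3.
- by move=> y yA yv; apply: p3; [exact: neq|exact: neq|rewrite eq_sym].
- move=> x xA xu; have vu : v != u by rewrite eq_sym neq.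
  rewrite -(p3 v u x) //; [|by rewrite eq_sym neq|by rewrite eq_sym].
  by apply: eq_regsum => G _; rewrite [edge G u v]edgeC [edge G x v]edgeC.
move=> x y xA xu yA yv; apply: (mulfI n3).
have [uv uy xv xy] : [/\ u != v, u != y, x != v & x != y]
  by split; apply: neq.
have [ux vx vu] : [/\ u != x, v != x & v != u]
  by split; rewrite eq_sym // neq.
have vy : v != y by rewrite eq_sym.
rewrite regsum_edge2_disjoint; last first.
  by rewrite /= !inE !negb_or uv ux uy vx vy xy.
rewrite regsum_edgeE // !p3 //.
by rewrite /c; field; rewrite n1 n3.
Qed.

(** The terms of order [mu ^+ 2] cancel exactly, which leaves a variance of order
    [mu ^+ 2 / n] uniformly in the size of [A], without separate treatment of
    small or large sets. *)
Lemma cut_variance :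
  regsum (fun G => (cut G A - mu) ^+ 2) =
  2 * a * m * (a - 1) * (m - 1) * d%:R * (n - 1 - d%:R) /
    ((n - 1) ^+ 2 * (n - 2) * (n - 3)) * N.
Proof.
have E2 : regsum (fun G => cut G A ^+ 2) = a * m * (d%:R / (n - 1) * N *
  (d%:R + (a - 1) * (m - 1) * ((n - 4) * d%:R + 2) / ((n - 2) * (n - 3)))).
  transitivity (\sum_(u in A) \sum_(v in ~: A)
      regsum (fun G => edge G u v * cut G A)).
    rewrite -[RHS](eq_bigr _ (fun _ _ => regsum_sum _ _)) -regsum_sum.
    apply: eq_regsum => G _; rewrite expr2 {1}/cut mulr_suml.
    by apply: eq_bigr => x _; rewrite mulr_suml.
  under eq_bigr => u uA do under eq_bigr => v vA do rewrite regsum_edge_cut //.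
  by rewrite !sumr_const -[LHS]mulr_natl -[X in _ * X = _]mulr_natl mulrA.
have -> : regsum (fun G => (cut G A - mu) ^+ 2) =
    regsum (fun G => cut G A ^+ 2) - 2 * mu * regsum (cut^~ A) + mu ^+ 2 * N.
  rewrite -!regsumZ -regsumB -regsumD.
  by apply: eq_regsum => G _; ring.
rewrite E2 regsum_cut /mu -am.
move: n1 n2 n3; rewrite -am => ? ? ?.
by field; apply/and3P.
Qed.

End LargeOrder.

Lemma regsum_card (P : pred (sgraph T)) :
  regsum (fun G => (P G)%:R) = #|[set G : sgraph T | regular d G && P G]|%:R.
Proof.
rewrite -sum1_card natr_sum /regsum big_mkcond [RHS]big_mkcond /=.
by apply: eq_bigr => G _; rewrite inE; case: regular; case: (P G).
Qed.

Definition thin_cut A G : bool :=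
  cut G A < #|A|%:R * #|~: A|%:R * d%:R / (n - 1) / 2.

(** Chebyshev's inequality: a thin cut deviates from its mean [mu] by more than
    [mu / 2]. *)
Lemma regsum_thin_cut A : (0 < d)%N -> (6 <= #|T|)%N ->
  n * regsum (fun G => (thin_cut A G)%:R) <= 20 * N.
Proof.
move=> d_gt0 n_ge6; set a : R := #|A|%:R; set m : R := #|~: A|%:R.
have n6 : 6 <= n :> R by rewrite (ler_nat R 6).
have N0 : 0 <= N by apply: sumr_ge0.
have am : a + m = n by rewrite -natrD cardsC.
have n1 : 0 < n - 1 :> R by lra.
have d1 : 1 <= d%:R :> R by rewrite ler1n.
have cut0 G : 0 <= cut G A.
  by apply: sumr_ge0 => u _; apply: sumr_ge0 => v _; apply: ler0n.
(* If A is empty or full the mean is 0 and no cut lies below it. *)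
have [am0|am_neq0] := eqVneq (a * m) 0.
  rewrite /regsum big1 ?mulr0 ?mulr_ge0 // => G _.
  by rewrite /thin_cut -/a -/m am0 !mul0r ltNge cut0.
have a1 : 1 <= a.
  by rewrite ler1n lt0n; apply: contra_neq am_neq0; rewrite /a => ->; rewrite mul0r.
have m1 : 1 <= m.
  by rewrite ler1n lt0n; apply: contra_neq am_neq0; rewrite /m => ->; rewrite mulr0.
pose mu := a * m * d%:R / (n - 1).
have mu0 : 0 < mu by rewrite divr_gt0 ?mulr_gt0 //; lra.
have cheb : mu ^+ 2 / 4 * regsum (fun G => (thin_cut A G)%:R) <=
    regsum (fun G => (cut G A - mu) ^+ 2).
  rewrite -regsumZ; apply: ler_sum => G _.
  case: (boolP (thin_cut A G)) => [|_]; last by rewrite mulr0 sqr_ge0.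
  rewrite mulr1 /thin_cut -/a -/m -/mu => lt_mu.
  rewrite -[leRHS]sqrrN opprB (_ : _ / 4 = (mu / 2) ^+ 2); last by field.
  by rewrite ler_sqr ?nnegrE //; have := cut0 G; lra.
rewrite cut_variance ?(leq_trans _ n_ge6) // -/a -/m in cheb.
have bound : 2 * a * m * (a - 1) * (m - 1) * d%:R * (n - 1 - d%:R) /
    ((n - 1) ^+ 2 * (n - 2) * (n - 3)) <= mu ^+ 2 / 4 * (20 / n).
  have -> : mu ^+ 2 / 4 * (20 / n) =
      5 * (a * m * d%:R) ^+ 2 * ((n - 2) * (n - 3) / n) /
        ((n - 1) ^+ 2 * (n - 2) * (n - 3)).
    by rewrite /mu; field; rewrite !lt0r_neq0 //=; lra.
  have den0 : 0 <= ((n - 1) ^+ 2 * (n - 2) * (n - 3))^-1 :> R.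
    by rewrite invr_ge0 !mulr_ge0 ?sqr_ge0 //; lra.
  apply: ler_wpM2r => //.
  (* 5 (n - 2) (n - 3) - 2 n (n - 1) = (3 n - 5) (n - 6): hence n >= 6. *)
  have K1 : 2 * (n - 1) <= 5 * ((n - 2) * (n - 3) / n) :> R.
    rewrite mulrA ler_pdivlMr; last by lra.
    have : 0 <= (3 * n - 5) * (n - 6) :> R by apply: mulr_ge0; lra.
    lra.
  set K := (n - 2) * (n - 3) / n in K1 *.
  have t0 : 0 <= (a - 1) * (m - 1) by apply: mulr_ge0; lra.
  have t1 : (a - 1) * (m - 1) <= a * m by nra.
  have amd0 : 0 <= a * m * d%:R by rewrite !mulr_ge0 //; lra.
  have step1 : (a - 1) * (m - 1) * (2 * (n - 1 - d%:R)) <=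
      (a - 1) * (m - 1) * (5 * K) by apply: ler_wpM2l => //; lra.
  have step2 : (a - 1) * (m - 1) * (5 * K) <= a * m * d%:R * (5 * K).
    apply: ler_wpM2r; first by lra.
    by apply: le_trans t1 _; rewrite ler_peMr // mulr_ge0 //; lra.
  have := ler_wpM2l amd0 (le_trans step1 step2).
  by congr (_ <= _); ring.
have mu4 : 0 < mu ^+ 2 / 4 by rewrite divr_gt0 // exprn_gt0.
have : regsum (fun G => (thin_cut A G)%:R) <= 20 / n * N.
  rewrite -(ler_pM2l mu4) mulrA; apply: le_trans cheb _.
  exact: ler_wpM2r.
rewrite -(ler_pM2l (_ : 0 < n :> R)); last by lra.
by move=> /le_trans; apply; rewrite mulrA mulrCA divff ?mulr1 //; lra.
Qed.

End Moments.

(** * Existence of regular graphs *)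

Lemma cayley_subproof (Z : finZmodType) (S : {set Z}) :
  0 \notin S -> (forall x, (- x \in S) = (x \in S)) ->
  simple_adj [ffun p : Z * Z => p.2 - p.1 \in S].
Proof.
move=> S0 SN; apply/andP; split.
  apply/forallP => x; apply/forallP => y; rewrite !ffunE /=.
  by rewrite -SN opprB.
by apply/forallP => x; rewrite ffunE /= subrr.
Qed.

Lemma exists_regular_cayley (Z : finZmodType) (S : {set Z}) :
  0 \notin S -> (forall x, (- x \in S) = (x \in S)) ->
  exists G : sgraph Z, regular #|S| G.
Proof.
move=> S0 SN; exists (SGraph (cayley_subproof S0 SN)).
apply/forallP => x; rewrite -(card_imset S (addIr x)).
apply/eqP/eq_card => y; rewrite inE /adj /= ffunE /=.
by rewrite -[y in RHS](subrK x) (mem_imset _ _ (addIr x)).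
Qed.

(** A circulant graph: the connection set is [{1..k}] and its opposite, where
    [k = d./2], together with the involution [n / 2] of [Z/n] if [d] is odd; in
    that case [n] is even. *)
Lemma exists_regular n d : (d < n)%N -> ~~ odd (n * d) ->
  exists G : sgraph 'I_n, regular d G.
Proof.
case: n => // n lt_dn even_nd; pose k := d./2.
have dE : d = (odd d + k.*2)%N by rewrite odd_double_half.
have lt_kn : (k.*2 < n.+1)%N by apply: leq_ltn_trans lt_dn; rewrite [leqRHS]dE leq_addl.
clearbody k.
pose S1 := [set r : 'I_n.+1 | (0 < r <= k)%N].
pose S2 := [set r : 'I_n.+1 | - r \in S1].
pose S3 := [set r : 'I_n.+1 | odd d && (r.*2 == n.+1)%N].
have valN (r : 'I_n.+1) :
    nat_of_ord (- r) = if r == 0 then 0%N else (n.+1 - r)%N.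
  have [->|r0] := eqVneq r 0; first by rewrite oppr0.
  rewrite /= modn_small // ltn_subrL /= andbT lt0n.
  by apply: contra_neq r0 => r0; apply: val_inj.
have valE (r : 'I_n.+1) : (r == 0) = ((r : nat) == 0)%N by [].
have cardS1 : #|S1| = k.
  have -> : S1 = [set inord i.+1 | i : 'I_k].
    apply/setP => r; rewrite inE; apply/andP/imsetP => [[r0 rk]|[i _ ->]].
      have lt_rk : (r.-1 < k)%N by lia.
      exists (Ordinal lt_rk) => //=; rewrite prednK //.
      by apply: val_inj; rewrite /= inordK.
    by have lt_ik := ltn_ord i; rewrite inordK /=; lia.
  rewrite card_imset ?card_ord // => i j /(congr1 val) /=.
  have lt_ik := ltn_ord i; have lt_jk := ltn_ord j.
  by rewrite !inordK; [move=> [] /val_inj|lia|lia].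
have cardS2 : #|S2| = k.
  by rewrite -cardS1 -(card_imset S2 oppr_inj); apply: eq_card => r;
     rewrite -[r in LHS]opprK mem_imset ?inE ?opprK //; apply: oppr_inj.
have cardS3 : #|S3| = odd d.
  case od : (odd d); last by apply: eq_card0 => r; rewrite inE od.
  have lt_half : (n.+1./2 < n.+1)%N by lia.
  rewrite [RHS]/= -(cards1 (Ordinal lt_half)); apply: eq_card => r.
  rewrite !inE od -val_eqE /=; move: even_nd; rewrite oddM od andbT; lia.
pose S := S1 :|: S2 :|: S3.
have cardS : #|S| = d.
  rewrite [RHS]dE cardsU cardsU cardS1 cardS2 cardS3.
  have -> : S1 :&: S2 = finset.set0.
    by apply/setP => r; rewrite !inE valN valE; case: ifP; lia.
  have -> : (S1 :|: S2) :&: S3 = finset.set0.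
    by apply/setP => r; rewrite !inE valN valE; case: ifP; lia.
  by rewrite !cards0 !subn0 addnn addnC.
have [||G rG] := @exists_regular_cayley _ S; last by exists G; rewrite -cardS.
- by rewrite !inE oppr0 /=; lia.
move=> r; rewrite !inE opprK !valN valE; have := ltn_ord r.
case: ifP; lia.
Qed.

(** * From thick cuts to the Poincare inequality *)

Lemma dist_eq0 (T : finType) (G : sgraph T) (cG : connected_graph G) x y :
  (dist cG x y == 0%N) = (x == y).
Proof.
rewrite /dist; case: ex_minnP => k walk_k min_k.
apply/eqP/eqP => [k0|eq_xy].
  move: walk_k; rewrite k0 => /existsP[p]; rewrite tuple0 /=.
  by move=> /eqP.
have: has_walk G x y 0 by apply/existsP; exists [tuple]; rewrite /= eq_xy eqxx.
by move=> /min_k; rewrite leqn0 => /eqP.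
Qed.

Section Poincare.
Variables (R : realType) (T W : finType) (d : nat) (f : T -> W).
Variables (rho : W -> W -> nat) (D : nat).
Hypothesis d_gt0 : (0 < d)%N.
Hypothesis rho_eq0 : forall x y, (rho x y == 0%N) = (x == y).
Hypothesis rho_le : forall x y, (rho x y <= D)%N.

Definition fiber w : {set T} := [set u | f u == w].

(** Both sums split along the fibers: each pair of vertices in different fibers
    contributes at most [D ^+ 2] to the first, and each edge between different
    fibers at least 1 to the second. *)
Lemma gamma_le_thick (G : sgraph T) : (2 <= #|T|)%N ->
    (forall w, ~~ thin_cut R d (fiber w) G) ->
  gamma_le d G rho f (2 * D%:R ^+ 2 : R).
Proof.
move=> n_ge2 thick; rewrite /gamma_le; set n : R := #|T|%:R.
set P := \sum_u _; set E := \sum_u _.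
pose M : R := \sum_w #|fiber w|%:R * #|~: fiber w|%:R.
have n2 : 2 <= n by rewrite /n (ler_nat R 2).
have d1 : 1 <= d%:R :> R by rewrite ler1n.
have M0 : 0 <= M by apply: sumr_ge0 => w _; rewrite mulr_ge0.
have rho1 x y : x != y -> 1 <= (rho x y)%:R ^+ 2 :> R.
  by move=> xy; rewrite exprn_ege1 // ler1n lt0n rho_eq0.
have P_le : P <= D%:R ^+ 2 * M.
  rewrite /P (partition_big f predT) //= mulr_sumr; apply: ler_sum => w _.
  rewrite mulrCA -sumr_const mulr_suml.
  rewrite (eq_bigl [in fiber w]); last by move=> u; rewrite inE.
  apply: ler_sum => u; rewrite inE => /eqP fu.
  rewrite mul1r mulr_natr -sumr_const [leRHS]big_mkcond /=.
  apply: ler_sum => v _; rewrite !inE fu; case: (eqVneq (f v) w) => [->|_] /=.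
    by have /eqP-> : rho w w == 0%N; rewrite ?rho_eq0 ? expr0n.
  by rewrite ler_sqr ?nnegrE // ler_nat.
have E_ge : M * d%:R / (n - 1) / 2 <= E.
  rewrite /E (partition_big f predT) //= /M !mulr_suml; apply: ler_sum => w _.
  have := thick w; rewrite /thin_cut -leNgt => /le_trans; apply.
  rewrite (eq_bigl [in fiber w]); last by move=> u; rewrite inE.
  rewrite /cut; apply: ler_sum => u; rewrite inE => /eqP fu.
  rewrite [leLHS]big_mkcond [leRHS]big_mkcond /=.
  apply: ler_sum => v _; rewrite !inE /edge fu.
  case: (adj G u v); case: (eqVneq (f v) w) => [_|fv] //=; rewrite ?sqr_ge0 //.
  by rewrite rho1 // eq_sym.
have C0 : 0 <= 2 * D%:R ^+ 2 / (d%:R * n) :> R.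
  by rewrite divr_ge0 ?mulr_ge0 ?sqr_ge0 //; lra.
apply: le_trans (ler_wpM2l C0 E_ge).
have -> : 2 * D%:R ^+ 2 / (d%:R * n) * (M * d%:R / (n - 1) / 2) =
    D%:R ^+ 2 * M * (n * (n - 1))^-1.
  by field; rewrite !lt0r_neq0 //; lra.
rewrite div1r mulrC; apply: ler_pM => //.
- by apply: sumr_ge0 => u _; apply: sumr_ge0 => v _; apply: sqr_ge0.
- by rewrite invr_ge0 sqr_ge0.
by rewrite lef_pV2 ?posrE ?exprn_gt0 ?mulr_gt0 //; nra.
Qed.

(** Union bound over the fibers. *)
Lemma regsum_not_gamma_le : (6 <= #|T|)%N ->
  regsum d (fun G : sgraph T => (~~ gamma_le d G rho f (2 * D%:R ^+ 2 : R))%:R)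
  <= 20 * #|W|%:R / #|T|%:R * regsum d (fun _ : sgraph T => 1) :> R.
Proof.
move=> n_ge6; have n0 : 0 < #|T|%:R :> R by rewrite ltr0n; lia.
apply: (@le_trans _ _ (\sum_(w : W)
    regsum d (fun G : sgraph T => (thin_cut R d (fiber w) G)%:R))).
  rewrite -regsum_sum; apply: ler_sum => G _.
  case: (boolP [forall w, ~~ thin_cut R d (fiber w) G]) => [/forallP thick|].
    rewrite gamma_le_thick //=; last exact: leq_trans n_ge6.
    exact: sumr_ge0.
  rewrite negb_forall => /existsP[w]; rewrite negbK => thin.
  rewrite (bigD1 w) //= thin; apply: (@le_trans _ _ 1); first by case: (~~ _).
  by rewrite lerDl sumr_ge0.
apply: (@le_trans _ _ (\sum_(w : W) 20 / #|T|%:R * regsum d (fun _ : sgraph T => 1))).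
  apply: ler_sum => w _; rewrite -(ler_pM2l n0).
  have -> x : #|T|%:R * (20 / #|T|%:R * x) = 20 * x :> R.
    by field; apply: lt0r_neq0.
  exact: regsum_thin_cut.
by rewrite sumr_const -[leLHS]mulr_natl le_eqVlt; apply/orP; left; apply/eqP; ring.
Qed.

End Poincare.

Lemma prob_regularE (R : realType) n d (P : pred (sgraph 'I_n)) :
  (exists G : sgraph 'I_n, regular d G) ->
  prob_regular R d P =
  1 - regsum d (fun G => (~~ P G)%:R) / regsum d (fun _ : sgraph 'I_n => 1).
Proof.
move=> [G0 regG0].
have NE : regsum d (fun _ : sgraph 'I_n => 1) =
    #|[set G : sgraph 'I_n | regular d G]|%:R :> R.
  by rewrite /regsum sumr_const cardsE.
have N0 : regsum d (fun _ : sgraph 'I_n => 1) != 0 :> R.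
  rewrite NE pnatr_eq0 -lt0n; apply/card_gt0P.
  by exists G0; rewrite inE.
rewrite /prob_regular -regsum_card -NE; apply: (mulIf N0).
rewrite mulrBl !divfK // mul1r -regsumB; apply: eq_regsum => G _.
by case: (P G); rewrite ?subr0 ?subrr.
Qed.

Local Open Scope classical_set_scope.
Local Open Scope ring_scope.

Theorem theorem5 (R : realType) (eps : R) (eps_gt0 : 0 < eps) (eps_lt1 : eps < 1)
    (d : nat) (d_gt0 : (0 < d)%N)
    (V : finType) (H : sgraph V) (cH : connected_graph H)
    (f : forall n : nat, 'I_n -> V) :
  exists C : R,
    prob_regular R d (fun G : sgraph 'I_n => gamma_le d G (dist cH) (f n) C)
      @[n --> within [set n : nat | ~~ odd (n * d)] \oo] --> (1 : R).
Proof.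
pose D := (\max_(x : V) \max_(y : V) dist cH x y)%N.
have dist_le x y : (dist cH x y <= D)%N.
  by rewrite (leq_trans (leq_bigmax y)) // (leq_bigmax x).
exists (2 * D%:R ^+ 2); apply/cvgrPdist_le => e e_gt0.
pose K : R := 20 * #|V|%:R.
have [t lt_t] : exists t : nat, K / e < t%:R.
  by exists (Num.truncn (K / e)).+1; apply: truncnS_gt.
exists (t + d + 6)%N => // n /= n_ge even_nd.
have n_ge6 : (6 <= #|'I_n|)%N by rewrite card_ord; lia.
rewrite prob_regularE; last by apply: exists_regular => //; lia.
rewrite opprB addrCA subrr addr0.
set N := regsum d (fun _ : sgraph 'I_n => 1).
have N0 : 0 <= N by apply: sumr_ge0.
have bad := @regsum_not_gamma_le R _ _ d (f n) _ D d_gt0 (dist_eq0 cH) dist_le n_ge6.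
rewrite ger0_norm; last by rewrite divr_ge0 //; apply: sumr_ge0.
have n_gt0 : 0 < n%:R :> R by rewrite ltr0n; lia.
have Kn : K / n%:R <= e.
  rewrite ler_pdivrMr // mulrC -ler_pdivrMr // ltW //.
  by apply: lt_le_trans lt_t _; rewrite ler_nat; lia.
have [->|N_neq0] := eqVneq N 0; first by rewrite invr0 mulr0 ltW.
rewrite ler_pdivrMr ?lt0r ?N_neq0 //; apply: le_trans bad _.
by rewrite card_ord; apply: ler_wpM2r.
Qed.
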